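(* Let $\mathbb{X}$ be a Cartesian differential category with differential combinator $\mathsf{D}$. Then $\mathbb{X}$ is a Cartesian difference category, where the infinitesimal extension is defined by $\varepsilon(f) = 0$ for every map $f$ and the difference combinator is defined to be the differential combinator, $\boldsymbol\partial = \mathsf{D}$.
   Context: Composition is written $g\circ f$ (first $f$, then $g$). A Cartesian category is a category with chosen finite products: binary products $A\times B$ with projections $\pi_0:A\times B\to A$, $\pi_1:A\times B\to B$, pairing $\langle -,-\rangle$, $f\times g=\langle f\circ\pi_0,g\circ\pi_1\rangle$, and terminal object $\top$ with unique maps $!_A:A\to\top$. A left additive category is a category in which each hom-set is a commutative monoid $(+,0)$ with $(f+g)\circ h=f\circ h+g\circ h$ and $0\circ f=0$. A map $k$ is additive if $k\circ(f+g)=k\circ f+k\circ g$ and $k\circ 0=0$. A Cartesian left additive category is a Cartesian category that is also left additive and whose projections $\pi_0,\pi_1$ are all additive. A Cartesian differential category is a Cartesian left additive category with a differential combinator $\mathsf{D}$, assigning to each $f:A\to B$ a map $\mathsf{D}[f]:A\times A\to B$, such that (for all suitable maps): [CD.1] $\mathsf{D}[f+g]=\mathsf{D}[f]+\mathsf{D}[g]$, $\mathsf{D}[0]=0$; [CD.2] $\mathsf{D}[f]\circ\langle x,y+z\rangle=\mathsf{D}[f]\circ\langle x,y\rangle+\mathsf{D}[f]\circ\langle x,z\rangle$, $\mathsf{D}[f]\circ\langle x,0\rangle=0$; [CD.3] $\mathsf{D}[1_A]=\pi_1$, $\mathsf{D}[\pi_0]=\pi_0\circ\pi_1$, $\mathsf{D}[\pi_1]=\pi_1\circ\pi_1$;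 [CD.4] $\mathsf{D}[\langle f,g\rangle]=\langle\mathsf{D}[f],\mathsf{D}[g]\rangle$, $\mathsf{D}[!_A]=!_{A\times A}$; [CD.5] $\mathsf{D}[g\circ f]=\mathsf{D}[g]\circ\langle f\circ\pi_0,\mathsf{D}[f]\rangle$; [CD.6] $\mathsf{D}[\mathsf{D}[f]]\circ\langle\langle x,y\rangle,\langle 0,z\rangle\rangle=\mathsf{D}[f]\circ\langle x,z\rangle$; [CD.7] $\mathsf{D}[\mathsf{D}[f]]\circ\langle\langle x,y\rangle,\langle z,0\rangle\rangle=\mathsf{D}[\mathsf{D}[f]]\circ\langle\langle x,z\rangle,\langle y,0\rangle\rangle$. An infinitesimal extension $\varepsilon$ on a Cartesian left additive category $\mathbb{X}$ consists of functions $\varepsilon:\mathbb{X}(A,B)\to\mathbb{X}(A,B)$ for all $A,B$ such that [E.1] $\varepsilon(f+g)=\varepsilon(f)+\varepsilon(g)$, $\varepsilon(0)=0$; [E.2] $\varepsilon(g\circ f)=\varepsilon(g)\circ f$; [E.3] $\varepsilon(\pi_i)=\pi_i\circ\varepsilon(1_{A\times B})$ for $i=0,1$. A Cartesian difference category is a Cartesian left additive category with an infinitesimal extension $\varepsilon$ and a difference combinator $\boldsymbol\partial$, assigning to each $f:A\to B$ a map $\boldsymbol\partial[f]:A\times A\to B$, such that (for all suitable maps): [C∂.0] $f\circ(x+\varepsilon(y))=f\circ x+\varepsilon(\boldsymbol\partial[f]\circ\langle x,y\rangle)$; [C∂.1] $\boldsymbol\partial[f+g]=\boldsymbol\partial[f]+\boldsymbol\partial[g]$,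 $\boldsymbol\partial[0]=0$, $\boldsymbol\partial[\varepsilon(f)]=\varepsilon(\boldsymbol\partial[f])$; [C∂.2] $\boldsymbol\partial[f]\circ\langle x,y+z\rangle=\boldsymbol\partial[f]\circ\langle x,y\rangle+\boldsymbol\partial[f]\circ\langle x+\varepsilon(y),z\rangle$, $\boldsymbol\partial[f]\circ\langle x,0\rangle=0$; [C∂.3] $\boldsymbol\partial[1_A]=\pi_1$, $\boldsymbol\partial[\pi_0]=\pi_0\circ\pi_1$, $\boldsymbol\partial[\pi_1]=\pi_1\circ\pi_1$; [C∂.4] $\boldsymbol\partial[\langle f,g\rangle]=\langle\boldsymbol\partial[f],\boldsymbol\partial[g]\rangle$; [C∂.5] $\boldsymbol\partial[g\circ f]=\boldsymbol\partial[g]\circ\langle f\circ\pi_0,\boldsymbol\partial[f]\rangle$; [C∂.6] $\boldsymbol\partial[\boldsymbol\partial[f]]\circ\langle\langle x,y\rangle,\langle 0,z\rangle\rangle=\boldsymbol\partial[f]\circ\langle x+\varepsilon(y),z\rangle$; [C∂.7] $\boldsymbol\partial[\boldsymbol\partial[f]]\circ\langle\langle x,y\rangle,\langle z,0\rangle\rangle=\boldsymbol\partial[\boldsymbol\partial[f]]\circ\langle\langle x,z\rangle,\langle y,0\rangle\rangle$. *)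

(* Defs.v *)
From HB Require Import structures.
From mathcomp Require Import ssreflect ssrfun ssrbool.

Set Implicit Arguments.
Unset Strict Implicit.
Unset Printing Implicit Defensive.

Declare Scope cat_scope.
Delimit Scope cat_scope with cat.
Local Open Scope cat_scope.

Reserved Notation "A ** B" (at level 38, left associativity).
(* Tighter than [+], unlike the function composition [\o] (same level). *)
Reserved Notation "g \c f" (at level 40, left associativity).
Reserved Notation "<| f , g |>" (at level 0, format "<| f ,  g |>").

(* The carrier of every structure below is the type of objects; equality of   *)
(* maps is Leibniz equality. Composition [g \c f] is first f, then g.         *)
HB.mixin Record isCategory C := {
  hom : C -> C -> Type;
  idmap : forall A, hom A A;
  comp : forall A B D, hom B D -> hom A B -> hom A D;
  comp_idl : forall A B (f : hom A B), comp A B B (idmap B) f = f;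
  comp_idr : forall A B (f : hom A B), comp A A B f (idmap A) = f;
  compA : forall A B D E (h : hom D E) (g : hom B D) (f : hom A B),
    comp A D E h (comp A B D g f) = comp A B E (comp B D E h g) f
}.

#[short(type="category")]
HB.structure Definition Category := { C of isCategory C }.

Bind Scope cat_scope with hom.
Arguments idmap {s} A : rename.
Arguments comp {s A B D} g f : rename.
Notation "g \c f" := (comp g f) : cat_scope.

HB.mixin Record Category_isCartesian C of Category C := {
  prodo : C -> C -> C;
  pi0 : forall A B, hom (prodo A B) A;
  pi1 : forall A B, hom (prodo A B) B;
  pairing : forall Z A B, hom Z A -> hom Z B -> hom Z (prodo A B);
  pi0_pairing : forall Z A B (f : hom Z A) (g : hom Z B),
    pi0 A B \c pairing Z A B f g = f;
  pi1_pairing : forall Z A B (f : hom Z A) (g : hom Z B),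
    pi1 A B \c pairing Z A B f g = g;
  pairing_unique : forall Z A B (f : hom Z A) (g : hom Z B)
      (h : hom Z (prodo A B)),
    pi0 A B \c h = f -> pi1 A B \c h = g -> h = pairing Z A B f g;
  topo : C;
  bang : forall A, hom A topo;
  bang_unique : forall A (f : hom A topo), f = bang A
}.

#[short(type="cartesianCategory")]
HB.structure Definition CartesianCategory :=
  { C of Category_isCartesian C & Category C }.

Arguments pi0 {s A B} : rename.
Arguments pi1 {s A B} : rename.
Arguments pairing {s Z A B} f g : rename.
Arguments bang {s} A : rename.
Notation "A ** B" := (prodo A B) : cat_scope.
Notation "<| f , g |>" := (pairing f g) : cat_scope.

(* Hom-sets are bare commutative monoids: MathComp's nmodType would moreover  *)
(* impose a choiceType structure on them.                                     *)
HB.mixin Record Category_isLeftAdditive C of Category C := {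
  hom0 : forall A B : C, hom A B;
  homD : forall A B : C, hom A B -> hom A B -> hom A B;
  homDA : forall A B : C, associative (homD A B);
  homDC : forall A B : C, commutative (homD A B);
  hom0D : forall A B : C, left_id (hom0 A B) (homD A B);
  compDl : forall (A B D : C) (f g : hom B D) (h : hom A B),
    homD B D f g \c h = homD A D (f \c h) (g \c h);
  comp0l : forall (A B D : C) (f : hom A B), hom0 B D \c f = hom0 A D
}.

#[short(type="leftAdditiveCategory")]
HB.structure Definition LeftAdditiveCategory :=
  { C of Category_isLeftAdditive C & Category C }.

Arguments hom0 {s A B} : rename.
Arguments homD {s A B} f g : rename.
Notation "0" := hom0 : cat_scope.
Notation "f + g" := (homD f g) : cat_scope.

Definition additive_map (C : leftAdditiveCategory) (A B : C) (k : hom A B) :=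
  (forall (Z : C) (f g : hom Z A), k \c (f + g) = k \c f + k \c g) /\
  (forall Z : C, k \c (0 : hom Z A) = 0).

HB.mixin Record isCartesianLeftAdditive C
    of CartesianCategory C & LeftAdditiveCategory C := {
  pi0_additive : forall A B : C, additive_map (pi0 : hom (A ** B) A);
  pi1_additive : forall A B : C, additive_map (pi1 : hom (A ** B) B)
}.

#[short(type="cartesianLeftAdditiveCategory")]
HB.structure Definition CartesianLeftAdditiveCategory :=
  { C of isCartesianLeftAdditive C & CartesianCategory C
       & LeftAdditiveCategory C }.

Definition combinator (X : cartesianLeftAdditiveCategory) :=
  forall A B : X, hom A B -> hom (A ** A) B.

Section Combinators.
Variable X : cartesianLeftAdditiveCategory.
Implicit Types A B C Z : X.

Record is_differential_combinator (D : combinator X) : Prop := {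
  CD1_add : forall A B (f g : hom A B), D _ _ (f + g) = D _ _ f + D _ _ g;
  CD1_zero : forall A B, D _ _ (0 : hom A B) = 0;
  CD2_add : forall A B Z (f : hom A B) (x y z : hom Z A),
    D _ _ f \c <| x, y + z |> = D _ _ f \c <| x, y |> + D _ _ f \c <| x, z |>;
  CD2_zero : forall A B Z (f : hom A B) (x : hom Z A),
    D _ _ f \c <| x, 0 |> = 0;
  CD3_id : forall A, D _ _ (idmap A) = pi1;
  CD3_pi0 : forall A B, D _ _ (pi0 : hom (A ** B) A) = pi0 \c pi1;
  CD3_pi1 : forall A B, D _ _ (pi1 : hom (A ** B) B) = pi1 \c pi1;
  CD4_pairing : forall A B C (f : hom A B) (g : hom A C),
    D _ _ <| f, g |> = <| D _ _ f, D _ _ g |>;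
  CD4_bang : forall A, D _ _ (bang A) = bang (A ** A);
  CD5 : forall A B C (f : hom A B) (g : hom B C),
    D _ _ (g \c f) = D _ _ g \c <| f \c pi0, D _ _ f |>;
  CD6 : forall A B Z (f : hom A B) (x y z : hom Z A),
    D _ _ (D _ _ f) \c <| <| x, y |>, <| 0, z |> |> = D _ _ f \c <| x, z |>;
  CD7 : forall A B Z (f : hom A B) (x y z : hom Z A),
    D _ _ (D _ _ f) \c <| <| x, y |>, <| z, 0 |> |>
      = D _ _ (D _ _ f) \c <| <| x, z |>, <| y, 0 |> |>
}.

Record is_infinitesimal_extension
    (eps : forall A B, hom A B -> hom A B) : Prop := {
  E1_add : forall A B (f g : hom A B),
    eps _ _ (f + g) = eps _ _ f + eps _ _ g;
  E1_zero : forall A B, eps _ _ (0 : hom A B) = 0;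
  E2 : forall A B C (f : hom A B) (g : hom B C),
    eps _ _ (g \c f) = eps _ _ g \c f;
  E3_pi0 : forall A B,
    eps _ _ (pi0 : hom (A ** B) A) = pi0 \c eps _ _ (idmap (A ** B));
  E3_pi1 : forall A B,
    eps _ _ (pi1 : hom (A ** B) B) = pi1 \c eps _ _ (idmap (A ** B))
}.

Record is_difference_combinator
    (eps : forall A B, hom A B -> hom A B) (d : combinator X) : Prop := {
  Cd0 : forall A B Z (f : hom A B) (x y : hom Z A),
    f \c (x + eps _ _ y) = f \c x + eps _ _ (d _ _ f \c <| x, y |>);
  Cd1_add : forall A B (f g : hom A B), d _ _ (f + g) = d _ _ f + d _ _ g;
  Cd1_zero : forall A B, d _ _ (0 : hom A B) = 0;
  Cd1_eps : forall A B (f : hom A B), d _ _ (eps _ _ f) = eps _ _ (d _ _ f);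
  Cd2_add : forall A B Z (f : hom A B) (x y z : hom Z A),
    d _ _ f \c <| x, y + z |>
      = d _ _ f \c <| x, y |> + d _ _ f \c <| x + eps _ _ y, z |>;
  Cd2_zero : forall A B Z (f : hom A B) (x : hom Z A),
    d _ _ f \c <| x, 0 |> = 0;
  Cd3_id : forall A, d _ _ (idmap A) = pi1;
  Cd3_pi0 : forall A B, d _ _ (pi0 : hom (A ** B) A) = pi0 \c pi1;
  Cd3_pi1 : forall A B, d _ _ (pi1 : hom (A ** B) B) = pi1 \c pi1;
  Cd4 : forall A B C (f : hom A B) (g : hom A C),
    d _ _ <| f, g |> = <| d _ _ f, d _ _ g |>;
  Cd5 : forall A B C (f : hom A B) (g : hom B C),
    d _ _ (g \c f) = d _ _ g \c <| f \c pi0, d _ _ f |>;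
  Cd6 : forall A B Z (f : hom A B) (x y z : hom Z A),
    d _ _ (d _ _ f) \c <| <| x, y |>, <| 0, z |> |>
      = d _ _ f \c <| x + eps _ _ y, z |>;
  Cd7 : forall A B Z (f : hom A B) (x y z : hom Z A),
    d _ _ (d _ _ f) \c <| <| x, y |>, <| z, 0 |> |>
      = d _ _ (d _ _ f) \c <| <| x, z |>, <| y, 0 |> |>
}.

Record is_cartesian_difference_category
    (eps : forall A B, hom A B -> hom A B) (d : combinator X) : Prop := {
  difference_eps : is_infinitesimal_extension eps;
  difference_comb : is_difference_combinator eps d
}.

End Combinators.

HB.mixin Record isCartesianDifferential X
    of CartesianLeftAdditiveCategory X := {
  diff : combinator X;
  diffP : is_differential_combinator diff
}.

#[short(type="cartesianDifferentialCategory")]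
HB.structure Definition CartesianDifferentialCategory :=
  { X of isCartesianDifferential X & CartesianLeftAdditiveCategory X }.

Arguments diff {s A B} f : rename.

(* Main.v *)
From mathcomp Require Import ssreflect ssrfun.
Require Import Defs.

Local Open Scope cat_scope.

(** When [eps] is zero, every perturbed point [x + eps y] collapses to [x] by [homD0], so [Cd0]
    becomes trivial and the difference axioms [Cd2_add] and [Cd6] become [CD2_add] and [CD6]. *)

Lemma homD0 (C : leftAdditiveCategory) (A B : C) (f : hom A B) : f + 0 = f.
Proof. by rewrite homDC hom0D. Qed.

Theorem proposition4p10 (X : cartesianDifferentialCategory) :
  is_cartesian_difference_category
    (fun (A B : X) (_ : hom A B) => 0) (fun A B : X => @diff X A B).
Proof.
have [D1a D10 D2a D20 D3 D3p0 D3p1 D4 _ D5 D6 D7] := @diffP X.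
(* The axioms free of [eps] are differential axioms verbatim; [Cd1_eps] reduces to [D[0] = 0]. *)
split; split=> //.
- by move=> A B _ _; rewrite homD0.
- by move=> A B C f g; rewrite comp0l.
(* [E3_pi0] and [E3_pi1] now say that the projections preserve zero. *)
- by move=> A B; rewrite (pi0_additive A B).2.
- by move=> A B; rewrite (pi1_additive A B).2.
- by move=> A B Z f x y; rewrite !homD0.
- by move=> A B Z f x y z; rewrite homD0 D2a.
- by move=> A B Z f x y z; rewrite homD0 D6.
Qed.
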